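(* Let $\alpha>0$, $b\geq 0$, $c\in\mathbb R$, $\nu,\phi,\psi\in\mathbb C$, and consider the linear system on a vector function $Y=(Y_1(z),Y_2(z))$ $$Y'=\left(\frac{1}{z}\begin{pmatrix}\nu&0\\ 0&0\end{pmatrix}+\frac{1}{z-\alpha}\begin{pmatrix}\phi&b\\ -b&\phi-\bar\nu-c\end{pmatrix}+\frac{1}{z-\alpha^{-1}}\begin{pmatrix}\psi-\nu-c&-b\\ b&\psi\end{pmatrix}\right)Y.$$ Suppose $\alpha\neq1$ and $b\neq0$. 1) The following two statements are equivalent: (i) the system is equivalent to a Heun equation with singularities $0,\alpha,\alpha^{-1},\infty$, i.e., there is a Heun equation with these singularities such that for each solution $Y=(Y_1,Y_2)$ of the system the component $E=Y_2(z)$ satisfies this Heun equation; (ii) one has $$b^2=\phi(\bar\nu+c-\phi)=\psi(\nu+c-\psi)\in\mathbb R_{\geq0};\qquad\text{either }\psi=\bar\phi,\ \text{ or }\ \psi=\nu+c-\bar\phi.$$ 2) If (ii) holds, then the corresponding Heun equation is $$z(z-\alpha^{-1})(z-\alpha)E''+\bigl(-\nu(z-\alpha)(z-\alpha^{-1})+qz(z-\alpha^{-1})+sz(z-\alpha)\bigr)E'+(uz+d)E=0,$$ where $$q=\bar\nu+c+1-2\phi,\quad s=\nu+c+1-2\psi,\quad u=(\bar\nu+c-\phi-\psi)(c+1-\phi-\psi),\quad d=\nu\bigl((c+\bar\nu-\phi)\alpha^{-1}-\psi\alpha\bigr),$$ and $s=\bar q$ if $\psi=\bar\phi$, while $s=2-\bar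 q$ if $\psi=\nu+c-\bar\phi$. Thus, the family of these Heun equations depends on five real parameters: a complex parameter $\nu$; two real parameters $\alpha$ and $c$; a complex parameter $\phi$ such that $\phi(\bar\nu+c-\phi)\in\mathbb R_+$; together with a double choice $\psi\in\{\bar\phi,\ \nu+c-\bar\phi\}$.
   Context: A Heun equation with four distinct singularities $0,\alpha,\beta,\infty$ is an equation of the form $$z(z-\alpha)(z-\beta)E''+\bigl(p(z-\alpha)(z-\beta)+qz(z-\beta)+sz(z-\alpha)\bigr)E'+(uz+d)E=0$$ with complex constants $p,q,s,u,d$. Here $\beta=\alpha^{-1}$. *)

(* Defs.v *)
(* MathComp / MathComp-Analysis. The complex numbers are R[i] for R : realType;
   z^* is complex conjugation, x%:C embeds x : R, and the partial order of R[i]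
   satisfies: 0 <= z iff z is a nonnegative real number. *)
From HB Require Import structures.
From mathcomp Require Import all_boot all_order all_algebra.
From mathcomp Require Import complex.
From mathcomp Require Import all_classical all_reals all_analysis.

Set Implicit Arguments.
Unset Strict Implicit.
Unset Printing Implicit Defensive.

Import Order.TTheory GRing.Theory Num.Theory.
Import numFieldNormedType.Exports.

Local Open Scope ring_scope.

Notation "x %:C" := (real_complex _ x) (format "x %:C") : ring_scope.

(* R[i] carries the topology of its modulus and is a normed module over itself,
   so that [is_derive z 1 f l] and [derive1 f z] are complex derivatives. *)
HB.instance Definition _ (R : rcfType) := NormedModule.copy R[i] R[i]^o.

(* The Heun equation with singularities 0, heun_alpha, heun_beta, oo:
   z (z - alpha) (z - beta) E''
   + (p (z - alpha) (z - beta) + q z (z - beta) + s z (z - alpha)) E'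
   + (u z + d) E = 0. *)
Record heun_equation (R : realType) := Heun {
  heun_alpha : R[i];
  heun_beta : R[i];
  heun_p : R[i];
  heun_q : R[i];
  heun_s : R[i];
  heun_u : R[i];
  heun_d : R[i] }.

Definition heun_solution (R : realType) (H : heun_equation R)
    (U : set R[i]) (E : R[i] -> R[i]) : Prop :=
  let: Heun a b p q s u d := H in
  forall z : R[i], U z ->
    [/\ derivable E z 1,
        derivable (derive1 E) z 1 &
        z * (z - a) * (z - b) * derive1 (derive1 E) z
        + (p * (z - a) * (z - b) + q * z * (z - b) + s * z * (z - a)) * derive1 E z
        + (u * z + d) * E z = 0].

Definition mx22 (R : realType) (a11 a12 a21 a22 : R[i]) : 'M[R[i]]_2 :=
  \matrix_(i, j) if i == 0 then (if j == 0 then a11 else a12)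
                 else (if j == 0 then a21 else a22).

Definition system_mx (R : realType) (alpha b c : R) (nu phi psi : R[i])
    (z : R[i]) : 'M[R[i]]_2 :=
  z^-1 *: mx22 nu 0
               0  0
  + (z - alpha%:C)^-1 *: mx22 phi      b%:C
                              (- b%:C) (phi - nu^* - c%:C)
  + (z - alpha%:C^-1)^-1 *: mx22 (psi - nu - c%:C) (- b%:C)
                                 b%:C              psi.

Definition system_solution (R : realType) (alpha b c : R) (nu phi psi : R[i])
    (U : set R[i]) (Y : R[i] -> 'cV[R[i]]_2) : Prop :=
  forall z : R[i], U z ->
    is_derive z 1 Y (system_mx alpha b c nu phi psi z *m Y z).

(* Solutions are multivalued on C \ {0, alpha, alpha^-1}; they are represented
   by their holomorphic branches on arbitrary open subsets U. The component
   Y_2 is the entry of index 1. *)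
Definition reduces_to_heun (R : realType) (alpha b c : R) (nu phi psi : R[i])
    (H : heun_equation R) : Prop :=
  forall (U : set R[i]) (Y : R[i] -> 'cV[R[i]]_2),
    open U ->
    (forall z, U z -> [/\ z != 0, z != alpha%:C & z != alpha%:C^-1]) ->
    system_solution alpha b c nu phi psi U Y ->
    heun_solution H U (fun z => Y z 1 0).

Definition equivalent_to_heun (R : realType) (alpha b c : R)
    (nu phi psi : R[i]) : Prop :=
  exists H : heun_equation R,
    [/\ heun_alpha H = alpha%:C, heun_beta H = alpha%:C^-1 &
        reduces_to_heun alpha b c nu phi psi H].

Definition corresponding_heun (R : realType) (alpha c : R)
    (nu phi psi : R[i]) : heun_equation R :=
  {| heun_alpha := alpha%:C;
     heun_beta := alpha%:C^-1;
     heun_p := - nu;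
     heun_q := nu^* + c%:C + 1 - 2 * phi;
     heun_s := nu + c%:C + 1 - 2 * psi;
     heun_u := (nu^* + c%:C - phi - psi) * (c%:C + 1 - phi - psi);
     heun_d := nu * ((c%:C + nu^* - phi) * alpha%:C^-1 - psi * alpha%:C) |}.

(* Main.v *)
Require Import Defs.
From mathcomp Require Import all_boot all_order all_algebra.
From mathcomp Require Import complex ring.
From mathcomp Require Import all_classical all_reals all_analysis.

(** Eliminating Y_1 from the system gives a scalar equation for E = Y_2: since
  the (2,1) entry a21 of the system matrix vanishes nowhere off the poles,
  Y_1 = (E' - a22 E) / a21, and substituting this in the first row yields a
  second order equation with the same E' coefficient as a Heun equation, but
  whose E coefficient has double poles at alpha and alpha^-1, with coefficients
  b^2 - phi (nu^* + c - phi) and b^2 - psi (nu + c - psi) there.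
  [second_component_heun_residual] states this in the form
    L_H E = T E' + S E,
  where L_H is the operator of an arbitrary Heun equation H with the given
  singularities, T is the quadratic polynomial built from the differences
  between the p, q, s of H and those of H0 = [corresponding_heun], and S gathers
  the differences in u and d and the two double-pole coefficients.

  If the double-pole coefficients vanish, H = H0 has T = S = 0,
  so it is satisfied by every Y_2. Conversely, suppose that H is satisfied by
  every Y_2. At a nonsingular point z0 the pair (Y_1, Y_2) can be prescribed
  ([system_local_solution]), hence so can (E, E') as a21 z0 is nonzero;
  thus T and S vanish off the three singularities. A rational function that
  vanishes off finitely many points is zero, which forces the two double-pole
  coefficients to vanish and H to be H0
  ([lagrange_eq0], [heun_potential_eq0]).  This is [reduces_to_heunP], from
  which everything else follows algebraically: conjugating
  b^2 = phi (nu^* + c - phi) shows that phi^* is a root of the quadratic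
  x (nu + c - x) = b^2, so its roots are phi^* and nu + c - phi^*, and the
  condition on psi says exactly that psi is one of them.

  The analytic content is the existence of holomorphic solutions with a
  prescribed initial value. It is proved for any Fuchsian system
  Y' = (sum_j (z - a_j)^-1 A_j) Y by power series ([fuchsian_local_solution]).
  Expanding Y together with the functions U_j = (z - a_j)^-1 Y turns the
  system into a one-step linear recursion on the coefficients, with no Cauchy
  product; its solutions grow at most geometrically, and a power series with
  geometrically bounded coefficients may be differentiated term by term near
  its centre ([power_sum_derive]). *)

Set Implicit Arguments.
Unset Strict Implicit.
Unset Printing Implicit Defensive.

Import Order.TTheory GRing.Theory Num.Theory numFieldNormedType.Exports.

Local Open Scope ring_scope.
Local Open Scope classical_set_scope.

(** * Geometrically bounded series of complex numbers *)

Lemma cvg_real_complex (R : realType) (v : nat -> R) (l : R) :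
  v @ \oo --> l -> (fun n => (v n)%:C : R[i]) @ \oo --> (l%:C : R[i]).
Proof.
move=> vl; apply/cvgrPdist_lt => e e0.
have ee : e = (complex.Re e)%:C by rewrite RRe_real// gtr0_real.
have e1 : 0 < complex.Re e by rewrite -ltcR -ee.
move/cvgrPdist_lt : vl => /(_ _ e1); apply: filterS => n vn.
by rewrite -rmorphB normc_def/= expr0n/= addr0 sqrtr_sqr ee ltcR.
Qed.

Lemma geometric_cvg_real (R : realType) (v : nat -> R) (B : R) :
  (forall n, `|v n| <= B * 2^-1 ^+ n) -> cvgn (series v).
Proof.
move=> vB; apply: normed_cvg.
apply: (@series_le_cvg _ _ (geometric B 2^-1)) => [n| |n|];
  [exact: normr_ge0 | |exact: vB|].
- by move=> n; rewrite /geometric/=; exact: le_trans (normr_ge0 _) (vB n).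
- by apply: is_cvg_geometric_series;
     rewrite ger0_norm ?invr_ge0 ?ler0n// invf_lt1 ?ltr1n.
Qed.

(** Convergence is checked on real and imaginary parts, where the completeness
  of R applies. *)
Lemma geometric_cvg (R : realType) (u : nat -> R[i]) (B : R[i]) :
  (forall n, `|u n| <= B * 2^-1 ^+ n) -> cvgn (series u).
Proof.
move=> uB.
have uB' n : `|u n| <= (complex.Re B * 2^-1 ^+ n)%:C.
  have B0 : 0 <= B by have := le_trans (normr_ge0 _) (uB 0%N); rewrite mulr1.
  rewrite rmorphM rmorphXn fmorphV rmorph_nat/=.
  by rewrite RRe_real ?ger0_real.
have Reb n : `|complex.Re (u n)| <= complex.Re B * 2^-1 ^+ n.
  by rewrite -lecR; exact: le_trans (normc_ge_Re _) (uB' n).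
have Imb n : `|complex.Im (u n)| <= complex.Re B * 2^-1 ^+ n.
  rewrite -lecR; apply: le_trans (uB' n).
  have := normc_ge_Re (u n * 'i%C).
  by rewrite ReiNIm normrN normrM complexiE normCi mulr1.
have /cvg_real_complex cRe := geometric_cvg_real Reb.
have /cvg_real_complex cIm := geometric_cvg_real Imb.
have -> : series u = (fun n => (series (fun n => complex.Re (u n)) n)%:C
   + 'i%C * (series (fun n => complex.Im (u n)) n)%:C).
  apply/funext => n; rewrite !seriesEnat/= !rmorph_sum mulr_sumr -big_split/=.
  by apply: eq_bigr => k _; exact: complexE.
by apply/cvg_ex; eexists; apply: cvgD cRe _; apply: cvgM cIm; exact: cvg_cst.
Qed.

(** The order on K may be partial; norms are real, hence comparable with M,
  which is real as an upper bound of norms. *)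
Lemma norm_lim_le (K : numFieldType) (u : nat -> K) (l M : K) :
  u @ \oo --> l -> (forall n, `|u n| <= M) -> `|l| <= M.
Proof.
move=> ul uM.
have Mr : M \is Num.real by exact: ger0_real (le_trans (normr_ge0 _) (uM 0%N)).
rewrite real_leNgt ?normr_real//; apply/negP => Ml.
move/cvgrPdist_lt : ul => /(_ (`|l| - M)); rewrite subr_gt0.
move=> /(_ Ml) [N _ /(_ N (leqnn N))].
rewrite ltrBrDr => h.
have : `|l| < `|l|; last by rewrite ltxx.
rewrite -{1}(subrK (u N) l); apply: le_lt_trans (ler_normD _ _) _.
by apply: le_lt_trans h; rewrite lerD2l.
Qed.

Lemma geometric_sum_le (K : numFieldType) (B : K) n :
  0 <= B -> \sum_(0 <= k < n) B * 2^-1 ^+ k <= 2 * B.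
Proof.
move=> B0.
suff -> : \sum_(0 <= k < n) B * 2^-1 ^+ k = 2 * B - 2 * B * 2^-1 ^+ n.
  by rewrite gerBl !mulr_ge0 ?exprn_ge0 ?invr_ge0.
elim: n => [|n IH]; first by rewrite big_nil expr0 mulr1 subrr.
by rewrite big_nat_recr//= IH exprS; field.
Qed.

Lemma geometric_lim_le (R : realType) (u : nat -> R[i]) (B : R[i]) :
  (forall n, `|u n| <= B * 2^-1 ^+ n) -> `|limn (series u)| <= 2 * B.
Proof.
move=> uB; have B0 : 0 <= B by have := le_trans (normr_ge0 _) (uB 0%N); rewrite mulr1.
apply: norm_lim_le (geometric_cvg uB) _ => n.
rewrite seriesEnat/=; apply: le_trans (ler_norm_sum _ _ _) _.
by apply: le_trans (geometric_sum_le n B0); exact: ler_sum.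
Qed.

Lemma lim_series_shift (R : realType) (u : nat -> R[i]) :
  cvgn (series u) -> limn (series u) = u 0%N + limn (series (fun n => u n.+1)).
Proof.
move=> cu.
have e : series u \o S = (fun n => u 0%N + series (fun n => u n.+1) n).
  by apply/funext => n; rewrite /= !seriesEnat/= big_nat_recl.
have cS : (series u \o S) @ \oo --> limn (series u).
  by rewrite (cvg_shiftS (series u)).
suff : series (fun n => u n.+1) @ \oo --> limn (series u) - u 0%N.
  by move/cvg_lim => -> //; rewrite addrC subrK.
have -> : series (fun n => u n.+1) = (fun n => (series u \o S) n - u 0%N).
  by apply/funext => n; rewrite e addrC addKr.
exact: cvgB cS (cvg_cst _).
Qed.

(** * Power series with geometrically bounded coefficients *)

(** A first order expansion with quadratic error determines the derivative; this
  replaces the interchange of a limit and an infinite sum by an inequality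
  between sums. *)
Lemma is_derive_quadratic_error (K : numFieldType) (f : K -> K) (z l B d : K) :
  0 < d -> 0 <= B ->
  (forall h, `|h| < d -> `|f (z + h) - f z - h * l| <= B * `|h| ^+ 2) ->
  is_derive z 1 f l.
Proof.
move=> d0 B0 fB.
have quot : (fun h => h^-1 *: ((f \o shift z) (h *: 1) - f z)) @ 0^' --> l.
  apply/cvgrPdist_le => e e0; near=> h.
  have h0 : h != 0 by near: h; exact: nbhs_dnbhs_neq.
  have hd : `|h| < d by near: h; apply: dnbhs0_lt.
  have he : `|h| <= e / (B + 1).
    by near: h; apply: dnbhs0_le; rewrite divr_gt0// ltr_wpDl.
  rewrite /= -[h *: 1]/(h * 1) mulr1 -[h^-1 *: _]/(h^-1 * _).
  have -> : l - h^-1 * (f (h + z) - f z) = - h^-1 * (f (z + h) - f z - h * l).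
    by rewrite (addrC h z); field.
  rewrite normrM normrN normfV mulrC ler_pdivrMr ?normr_gt0//.
  apply: le_trans (fB _ hd) _; rewrite expr2 mulrA ler_wpM2r//.
  apply: (@le_trans _ _ (B * (e / (B + 1)))); first by rewrite ler_wpM2l.
  by rewrite mulrA ler_pdivrMr ?ltr_wpDl// mulrC ler_wpM2l ?lerDl// ltW.
by apply: DeriveDef; [apply/cvg_ex; exists l|apply: cvg_lim].
Unshelve. all: by end_near. Qed.

(** Second order Taylor remainder of a power. The factor r ^+ 2 on the left
  avoids the exponent n - 2 on the right. *)
Lemma expr_second_order (K : numFieldType) (w h r : K) n :
  `|w| <= r -> `|w + h| <= r ->
  r ^+ 2 * `|(w + h) ^+ n - w ^+ n - h * (n%:R * w ^+ n.-1)|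
    <= `|h| ^+ 2 * (n%:R ^+ 2 * r ^+ n).
Proof.
move=> wr whr; have r0 : 0 <= r := le_trans (normr_ge0 w) wr.
elim: n => [|n IH].
  by rewrite !expr0 mul0r mulr0 subrr subr0 normr0 expr0n mul0r !mulr0.
have -> : (w + h) ^+ n.+1 - w ^+ n.+1 - h * (n.+1%:R * w ^+ n.+1.-1) =
    (w + h) * ((w + h) ^+ n - w ^+ n - h * (n%:R * w ^+ n.-1))
    + h ^+ 2 * (n%:R * w ^+ n.-1).
  case: n {IH} => [|n] /=; first by rewrite !expr0 expr1; ring.
  by rewrite !exprS -!natr1; ring.
apply: le_trans (ler_wpM2l (exprn_ge0 2 r0) (ler_normD _ _)) _.
rewrite mulrDr normrM mulrCA.
have t1 : `|w + h| * (r ^+ 2 * `|(w + h) ^+ n - w ^+ n - h * (n%:R * w ^+ n.-1)|)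
    <= `|h| ^+ 2 * (n%:R ^+ 2 * r ^+ n.+1).
  apply: le_trans (ler_pM _ _ whr IH) _; rewrite ?mulr_ge0 ?exprn_ge0//.
  by rewrite (exprS r) le_eqVlt; apply/orP; left; apply/eqP; ring.
have t2 : r ^+ 2 * `|h ^+ 2 * (n%:R * w ^+ n.-1)|
    <= `|h| ^+ 2 * (n%:R * r ^+ n.+1).
  rewrite !normrM normr_nat !normrX mulrCA ler_wpM2l ?exprn_ge0//.
  case: n {IH t1} => [|n]; first by rewrite !mul0r mulr0.
  rewrite mulrCA ler_wpM2l//= -[n.+2]/(2 + n)%N exprD.
  by rewrite ler_wpM2l ?exprn_ge0// lerXn2r ?nnegrE.
apply: le_trans (lerD t1 t2) _; rewrite -mulrDr -mulrDl.
rewrite ler_wpM2l ?exprn_ge0// ler_wpM2r ?exprn_ge0//.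
by rewrite -!natrX -natrD ler_nat -!mulnn -mulnSr leq_mul2r leqnSn orbT.
Qed.

Definition power_sum (R : realType) (a : nat -> R[i]) (w : R[i]) : R[i] :=
  limn (series (fun n => a n * w ^+ n)).

Section PowerSeries.
Variables (R : realType) (a : nat -> R[i]) (C K : R[i]).
Hypotheses (K0 : 0 < K) (aK : forall n, `|a n| <= C * K ^+ n).

Let C0 : 0 <= C.
Proof. by have := le_trans (normr_ge0 _) (aK 0%N); rewrite mulr1. Qed.

(* On the disc of radius r the terms are bounded by C 8^-n: two factors 2^-n
   absorb the n ^ 2 of the Taylor remainder, the third makes the sum converge. *)
Let r := (8 * K)^-1.

Let r0 : 0 < r. Proof. by rewrite invr_gt0 mulr_gt0. Qed.

Let Kr n : K ^+ n * r ^+ n = 2^-1 ^+ n * 2^-1 ^+ n * 2^-1 ^+ n.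
Proof.
rewrite -!exprMn; congr (_ ^+ n); rewrite /r; field; exact: lt0r_neq0.
Qed.

Let natr_half n : n%:R * 2^-1 ^+ n <= 1 :> R[i].
Proof.
by rewrite exprVn ler_pdivrMr ?exprn_gt0// mul1r -natrX ler_nat ltnW// ltn_expl.
Qed.

Let half_le1 n : 2^-1 ^+ n <= 1 :> R[i].
Proof. by rewrite exprn_ile1 ?invr_ge0// invf_le1 ?ler1n. Qed.

Lemma power_sum_term_le w n : `|w| <= r -> `|a n * w ^+ n| <= C * 2^-1 ^+ n.
Proof.
move=> wr; rewrite normrM normrX.
apply: (@le_trans _ _ (C * K ^+ n * r ^+ n)).
  by rewrite ler_pM ?exprn_ge0// lerXn2r ?nnegrE// ltW.
rewrite -mulrA ler_wpM2l// Kr -[leRHS]mul1r ler_wpM2r ?exprn_ge0 ?invr_ge0//.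
by rewrite mulr_ile1 ?exprn_ge0 ?invr_ge0.
Qed.

Lemma power_sum_cvg w : `|w| <= r -> cvgn (series (fun n => a n * w ^+ n)).
Proof. by move=> wr; apply: (@geometric_cvg _ _ C) => n; exact: power_sum_term_le. Qed.

(** Termwise differentiation: the error of the first order expansion at z is the
  sum of the Taylor remainders of the powers, each of which is quadratic in the
  increment with a geometrically decreasing constant. *)
Lemma power_sum_derive (z0 z : R[i]) : `|z - z0| < r ->
  is_derive z 1 (fun x => power_sum a (x - z0))
    (power_sum (fun n => n.+1%:R * a n.+1) (z - z0)).
Proof.
set w := z - z0 => wr.
pose e n := a n * (n%:R * w ^+ n.-1).
have e_le n : `|e n| <= C / r * 2^-1 ^+ n.
  rewrite mulrAC ler_pdivlMr// /e !normrM normrX normr_nat.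
  case: n => [|n]; first by rewrite mul0r mulr0 mul0r mulr1.
  apply: (@le_trans _ _ (C * (K ^+ n.+1 * r ^+ n.+1) * n.+1%:R)).
    have -> : C * (K ^+ n.+1 * r ^+ n.+1) * n.+1%:R
       = (C * K ^+ n.+1) * (n.+1%:R * r ^+ n) * r by rewrite (exprSr r); ring.
    rewrite ler_wpM2r//; first exact: ltW.
    rewrite ler_pM ?mulr_ge0 ?exprn_ge0//.
    by rewrite ler_wpM2l// lerXn2r ?nnegrE// ltW.
  rewrite -mulrA ler_wpM2l// Kr -!mulrA [_ * n.+1%:R]mulrC.
  by rewrite -[leRHS]mulr1 ler_wpM2l ?exprn_ge0 ?invr_ge0// mulr_ile1 ?mulr_ge0
              ?exprn_ge0 ?invr_ge0.
have e_cvg := geometric_cvg e_le.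
have -> : power_sum (fun n => n.+1%:R * a n.+1) w = limn (series e).
  rewrite (lim_series_shift e_cvg) /e mul0r mulr0 add0r /power_sum.
  by congr (limn (series _)); apply/funext => n /=; ring.
apply: (@is_derive_quadratic_error _ _ _ _ (2 * (C / r ^+ 2)) (r - `|w|)).
- by rewrite subr_gt0.
- by rewrite !mulr_ge0 ?invr_ge0 ?exprn_ge0// ltW.
move=> h; rewrite ltrBrDl => /ltW whr'.
have whr : `|w + h| <= r := le_trans (ler_normD _ _) whr'.
have -> : z + h - z0 = w + h by rewrite /w; ring.
have cu := power_sum_cvg whr; have cv := power_sum_cvg (ltW wr).
have cuv := is_cvg_seriesB cu cv; have che := @is_cvg_seriesZ _ _ h e_cvg.
rewrite /power_sum -(lim_seriesB cu cv) -[h * _]/(h *: _) -(lim_seriesZ _ e_cvg).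
rewrite -(lim_seriesB cuv che) -mulrA; apply: geometric_lim_le => n.
rewrite /= !fctE /e -[_ *: _]/(_ * _).
have -> : a n * (w + h) ^+ n - a n * w ^+ n - h * (a n * (n%:R * w ^+ n.-1)) =
   a n * ((w + h) ^+ n - w ^+ n - h * (n%:R * w ^+ n.-1)) by ring.
have -> : C / r ^+ 2 * `|h| ^+ 2 * 2^-1 ^+ n = C * `|h| ^+ 2 * 2^-1 ^+ n / r ^+ 2.
  by ring.
rewrite ler_pdivlMr ?exprn_gt0// normrM -[leLHS]mulrA [_ * r ^+ 2]mulrC.
apply: le_trans (ler_pM _ _ (aK n) (expr_second_order n (ltW wr) whr)) _.
- by [].
- by rewrite mulr_ge0 ?exprn_ge0// ltW.
have -> : C * K ^+ n * (`|h| ^+ 2 * (n%:R ^+ 2 * r ^+ n)) =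
  C * `|h| ^+ 2 * ((n%:R * 2^-1 ^+ n) ^+ 2 * 2^-1 ^+ n).
  transitivity (C * `|h| ^+ 2 * (n%:R ^+ 2 * (K ^+ n * r ^+ n))); first by ring.
  by rewrite Kr; ring.
rewrite ler_wpM2l ?mulr_ge0 ?exprn_ge0// -[leRHS]mul1r.
by rewrite ler_wpM2r ?exprn_ge0 ?invr_ge0// exprn_ile1 ?mulr_ge0 ?exprn_ge0 ?invr_ge0.
Qed.

End PowerSeries.

(** * Matrix-valued functions *)

Lemma cvg_sum (K : numFieldType) (V : normedModType K) (I T : Type)
    (F : set_system T) {FF : Filter F} (s : seq I) (f : I -> T -> V) (l : I -> V) :
  (forall i, f i @ F --> l i) ->
  (fun x => \sum_(i <- s) f i x) @ F --> \sum_(i <- s) l i.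
Proof. by move=> fl; apply: cvg_big => //; exact: add_continuous. Qed.

Lemma cvg_mxP (K : numFieldType) (T : Type) (F : set_system T) {FF : Filter F}
    m n (f : T -> 'M[K]_(m, n)) (l : 'M[K]_(m, n)) :
  f @ F --> l <-> forall i j, (fun x => f x i j) @ F --> l i j.
Proof.
split=> [fl i j|fl].
  exact: (cvg_comp _ _ fl (@coord_continuous K m n i j l)).
have -> : f = (fun x => \sum_i \sum_j f x i j *: delta_mx i j).
  by apply/funext => x; exact: matrix_sum_delta.
rewrite [X in _ --> X]matrix_sum_delta.
by apply: cvg_sum => i; apply: cvg_sum => j; apply: cvgZr_tmp; exact: fl.
Qed.

Lemma is_derive_mxP (K : numFieldType) m n (f : K -> 'M[K]_(m, n)) (z : K)
    (l : 'M[K]_(m, n)) :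
  is_derive z 1 f l <-> forall i j, is_derive z 1 (fun x => f x i j) (l i j).
Proof.
have quot i j : (fun h => (h^-1 *: ((f \o shift z) (h *: 1) - f z)) i j)
    = (fun h => h^-1 *: (((fun x => f x i j) \o shift z) (h *: 1) - f z i j)).
  by apply/funext => h; rewrite !mxE.
have defE (V : normedModType K) (g : K -> V) (d : V) : is_derive z 1 g d <->
    (fun h => h^-1 *: ((g \o shift z) (h *: 1) - g z)) @ 0^' --> d.
  split=> [[gz <-]|gd]; first by [].
  by apply: DeriveDef; [apply/cvg_ex; exists d|apply: cvg_lim].
split=> [/defE/cvg_mxP fl i j|fl]; first by apply/defE; rewrite -quot.
by apply/defE/cvg_mxP => i j; rewrite quot; apply/defE.
Qed.


Lemma power_sum_linear (R : realType) (I : finType) (b : I -> R[i])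
    (c : I -> nat -> R[i]) (w : R[i]) :
  (forall p, cvgn (series (fun k => c p k * w ^+ k))) ->
  power_sum (fun k => \sum_p b p * c p k) w = \sum_p b p * power_sum (c p) w.
Proof.
move=> cw; apply: cvg_lim => //.
have -> : series (fun k => (\sum_p b p * c p k) * w ^+ k) =
    (fun N => \sum_p b p * series (fun k => c p k * w ^+ k) N).
  apply/funext => N; rewrite seriesEnat/=.
  under eq_bigr do rewrite mulr_suml.
  rewrite exchange_big/=; apply: eq_bigr => p _.
  by rewrite seriesEnat/= mulr_sumr; apply: eq_bigr => k _; rewrite mulrA.
by apply: cvg_sum => p; apply: cvgM; [exact: cvg_cst|exact: cw].
Qed.

(** The recursion on u says that e + X times the series u is the series y: this
  is how division by z - a_j = e + w is expressed on coefficients. *)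
Lemma power_sum_mulDX (R : realType) (e w : R[i]) (u y : nat -> R[i]) :
  cvgn (series (fun k => u k * w ^+ k)) ->
  cvgn (series (fun k => y k * w ^+ k)) ->
  y 0%N = e * u 0%N -> (forall k, y k.+1 = e * u k.+1 + u k) ->
  power_sum y w = (e + w) * power_sum u w.
Proof.
move=> cu cy y0 yS.
have cu1 : cvgn (series (fun k => u k.+1 * w ^+ k.+1)).
  apply/cvg_ex; exists (power_sum u w - u 0%N).
  have -> : series (fun k => u k.+1 * w ^+ k.+1) =
      (fun N => (series (fun k => u k * w ^+ k) \o S) N - u 0%N).
    apply/funext => N; rewrite /= !seriesEnat/= big_nat_recl//= expr0 mulr1.
    by rewrite addrC addKr.
  have cS : (series (fun k => u k * w ^+ k) \o S) @ \oo --> power_sum u w.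
    by rewrite (cvg_shiftS (series (fun k => u k * w ^+ k))); exact: cu.
  exact: cvgB cS (cvg_cst _).
rewrite /power_sum (lim_series_shift cy) expr0 mulr1 y0.
have -> : (fun k => y k.+1 * w ^+ k.+1) =
    e *: (fun k => u k.+1 * w ^+ k.+1) + w *: (fun k => u k * w ^+ k).
  apply/funext => k; rewrite yS !fctE -[e *: _]/(e * _) -[w *: _]/(w * _) exprS.
  by ring.
have ce := @is_cvg_seriesZ _ _ e cu1; have cwu := @is_cvg_seriesZ _ _ w cu.
rewrite (lim_seriesD ce cwu) (lim_seriesZ _ cu1) (lim_seriesZ _ cu).
rewrite -[e *: _]/(e * _) -[w *: _]/(w * _) addrA mulrDl; congr (_ + _).
by rewrite (lim_series_shift cu) expr0 mulr1 mulrDr.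
Qed.

Lemma power_sum0 (R : realType) (a : nat -> R[i]) : power_sum a 0 = a 0%N.
Proof.
apply: cvg_lim => //; apply: cvg_near_cst; exists 1%N => // -[//|N] _ /=.
rewrite seriesEnat/= big_nat_recl//= expr0 mulr1 big1 ?addr0// => k _.
by rewrite expr0n mulr0.
Qed.

(** * Local solutions of Fuchsian systems *)

Lemma ler_sum1 (K : numDomainType) (I : finType) (f : I -> K) i :
  (forall j, 0 <= f j) -> f i <= \sum_j f j.
Proof. by move=> f0; rewrite (bigD1 i)//= lerDl sumr_ge0. Qed.

Section FuchsianSystem.
Variables (R : realType) (m n : nat).
Variables (a : 'I_m -> R[i]) (A : 'I_m -> 'M[R[i]]_n).
Variables (z0 : R[i]) (y0 : 'cV[R[i]]_n).
Hypothesis z0a : forall j, z0 != a j.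

(** Coefficients of order k at z0 of the solution Y and of the functions
  U_j = (z - a j)^-1 Y. They are determined by Y' = sum_j A j U_j and
  (z - a j) U_j = Y. *)
Fixpoint fuchsian_coef (k : nat) : 'cV[R[i]]_n * ('I_m -> 'cV[R[i]]_n) :=
  if k is k'.+1 then
    let: (y, u) := fuchsian_coef k' in
    let y' := k'.+1%:R^-1 *: \sum_j A j *m u j in
    (y', fun j => (z0 - a j)^-1 *: (y' - u j))
  else (y0, fun j => (z0 - a j)^-1 *: y0).

Local Notation y k := (fuchsian_coef k).1.
Local Notation u k := (fuchsian_coef k).2.

Lemma fuchsian_coefS k :
  y k.+1 = k.+1%:R^-1 *: \sum_j A j *m u k j /\
  forall j, u k.+1 j = (z0 - a j)^-1 *: (y k.+1 - u k j).
Proof. by rewrite /=; case: (fuchsian_coef k). Qed.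

Let e_neq0 j : z0 - a j != 0. Proof. by rewrite subr_eq0. Qed.

(** One step of the recursion multiplies the coefficients at most by a constant
  K. The bound on the |(z0 - a j)^-1| by K keeps the poles out of the disc
  where the series is used. *)
Lemma fuchsian_coef_geometric : exists C K : R[i], [/\ 0 < K,
  forall j, `|(z0 - a j)^-1| <= K,
  forall k i, `|y k i 0| <= C * K ^+ k &
  forall k j i, `|u k j i 0| <= C * K ^+ k].
Proof.
pose Sg := \sum_j \sum_i \sum_l `|A j i l|.
pose T := \sum_j `|(z0 - a j)^-1|.
pose L := 1 + Sg + T; pose K := L * (L + 1).
pose C := (\sum_i `|y0 i 0|) * L.
have Sg0 : 0 <= Sg by do 3!(apply: sumr_ge0 => ? _).
have T0 : 0 <= T by apply: sumr_ge0.
have SL : Sg <= L by rewrite /L addrAC lerDr addr_ge0.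
have TL : T <= L by rewrite lerDr addr_ge0.
have L1 : 1 <= L by rewrite /L -addrA lerDl addr_ge0.
have L0 : 0 < L := lt_le_trans ltr01 L1.
have LK : L <= K by have L0w := ltW L0; rewrite /K ler_peMr ?lerDr.
have K0 : 0 < K := lt_le_trans L0 LK.
have C0 : 0 <= C by rewrite mulr_ge0 ?sumr_ge0// ltW.
exists C, K.
have H k : (forall i, `|y k i 0| <= C * K ^+ k) /\
    (forall j i, `|u k j i 0| <= C * K ^+ k).
  elim: k => [|k [_ IHu]].
    rewrite expr0 mulr1; split=> [i|j i] /=.
      apply: (@le_trans _ _ (\sum_i `|y0 i 0|));
        first exact: (@ler_sum1 _ _ (fun i => `|y0 i 0|)).
      by rewrite ler_peMr// sumr_ge0.
    rewrite mxE normrM mulrC ler_pM//;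
      first exact: (@ler_sum1 _ _ (fun i => `|y0 i 0|)).
    by apply: le_trans TL; exact: (@ler_sum1 _ _ (fun j => `|(z0 - a j)^-1|)).
  have [yS uS] := fuchsian_coefS k.
  have CK0 : 0 <= C * K ^+ k by rewrite mulr_ge0 ?exprn_ge0 ?(ltW K0).
  have yL i : `|y k.+1 i 0| <= L * (C * K ^+ k).
    rewrite yS mxE normrM.
    apply: (@le_trans _ _ `|(\sum_j A j *m u k j) i 0|).
      by rewrite ler_piMl// normfV normr_nat invf_le1 ?ltr0n// ler1n.
    apply: le_trans (ler_wpM2r CK0 SL); rewrite summxE.
    apply: le_trans (ler_norm_sum _ _ _) _; rewrite mulr_suml.
    apply: ler_sum => j _; rewrite mxE.
    apply: le_trans (ler_norm_sum _ _ _) _.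
    apply: (@le_trans _ _ ((\sum_l `|A j i l|) * (C * K ^+ k))).
      by rewrite mulr_suml; apply: ler_sum => l _; rewrite normrM ler_wpM2l.
    rewrite ler_wpM2r//.
    by apply: (@ler_sum1 _ _ (fun i => \sum_l `|A j i l|)) => i'; rewrite sumr_ge0.
  split=> [i|j i].
    apply: le_trans (yL i) _; rewrite exprSr [leRHS]mulrA [leRHS]mulrC.
    by rewrite ler_wpM2r.
  rewrite uS 2!mxE normrM.
  have -> : C * K ^+ k.+1 = L * (L * (C * K ^+ k) + C * K ^+ k).
    by rewrite exprSr /K; ring.
  apply: ler_pM => //.
    by apply: le_trans TL; exact: (@ler_sum1 _ _ (fun j => `|(z0 - a j)^-1|)).
  by apply: le_trans (ler_normD _ _) _; rewrite mxE normrN lerD.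
split=> [//|j|k i|k j i]; try by have [] := H k.
by apply: le_trans (le_trans TL LK); exact: (@ler_sum1 _ _ (fun j => `|(z0 - a j)^-1|)).
Qed.

Lemma fuchsian_local_solution : exists (r : R[i]) (Y : R[i] -> 'cV[R[i]]_n),
  [/\ 0 < r, Y z0 = y0 &
    forall z, `|z - z0| < r -> (forall j, z != a j) /\
      is_derive z 1 Y ((\sum_j (z - a j)^-1 *: A j) *m Y z)].
Proof.
have [C [K [K0 aK yK uK]]] := fuchsian_coef_geometric.
exists (8 * K)^-1, (fun z => \col_i power_sum (fun k => y k i 0) (z - z0)).
split.
- by rewrite invr_gt0 mulr_gt0.
- by apply/colP => i; rewrite mxE subrr power_sum0.
move=> z zr; set w := z - z0 in zr *.
have cy i' := @power_sum_cvg _ _ _ _ K0 (yK^~ i') w (ltW zr).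
have cu j i' := @power_sum_cvg _ _ _ _ K0 (fun k => uK k j i') w (ltW zr).
have za j : z - a j != 0.
  apply/negP => /eqP zj; have := aK j.
  have -> : z0 - a j = - w by rewrite /w -[LHS]subr0 -zj; ring.
  rewrite normfV normrN => wK.
  have w0 : 0 < `|w|.
    rewrite normr_gt0; apply/eqP => w0; move: (e_neq0 j).
    by rewrite -(subrK z0 z) -/w w0 add0r in zj; rewrite zj eqxx.
  have : `|w|^-1 < `|w|^-1; last by rewrite ltxx.
  apply: le_lt_trans wK _; rewrite -[ltLHS]invrK ltf_pV2 ?posrE ?invr_gt0//.
  apply: lt_le_trans zr _; rewrite lef_pV2 ?posrE ?mulr_gt0//.
  by rewrite ler_peMl ?ler1n// ltW.
split=> [j|]; first by rewrite -subr_eq0.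
apply/is_derive_mxP => i c; rewrite [c]ord1 {c}.
have uy j i' : power_sum (fun k => u k j i' 0) w =
    (z - a j)^-1 * power_sum (fun k => y k i' 0) w.
  apply: (mulfI (za j)); rewrite mulrA mulfV// mul1r.
  have -> : z - a j = z0 - a j + w by rewrite /w; ring.
  apply/esym/power_sum_mulDX; first exact: cu; first exact: cy.
    by rewrite /= mxE mulrA mulfV// mul1r.
  move=> k; have [_ /(_ j) ->] := fuchsian_coefS k.
  by rewrite 3!mxE mulrA mulfV// mul1r subrK.
have dY := @power_sum_derive _ _ _ _ K0 (yK^~ i) z0 z zr.
have -> : (fun x => (\col_i power_sum (fun k => y k i 0) (x - z0)) i 0) =
    (fun x => power_sum (fun k => y k i 0) (x - z0)).
  by apply/funext => x; rewrite mxE.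
apply: is_derive_eq dY _; rewrite -/w.
have -> : (fun k => k.+1%:R * y k.+1 i 0) =
    (fun k => \sum_(p : 'I_m * 'I_n) A p.1 i p.2 * u k p.1 p.2 0).
  apply/funext => k; have [-> _] := fuchsian_coefS k.
  rewrite mxE mulrA mulfV ?pnatr_eq0// mul1r summxE.
  under eq_bigr do rewrite mxE.
  by rewrite pair_big.
rewrite power_sum_linear; last by move=> p; exact: cu.
rewrite mulmx_suml summxE.
rewrite -(pair_bigA _ (fun j l => A j i l * power_sum (fun k => u k j l 0) w)).
apply: eq_bigr => j _; rewrite mxE; apply: eq_bigr => l _.
by rewrite uy !mxE mulrA [A j i l * _]mulrC.
Qed.

End FuchsianSystem.

(** * Identities between rational functions *)

Lemma is_derive_invB (K : numFieldType) (a z : K) : z != a ->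
  is_derive z 1 (fun x : K => (x - a)^-1) (- (z - a)^-1 ^+ 2).
Proof.
rewrite -subr_eq0 => za.
have dB : is_derive z 1 (fun x : K => x - a) 1.
  rewrite -[1 in X in is_derive _ _ _ X]subr0.
  exact: is_deriveB (is_derive_id z 1) (is_derive_cst a z 1).
apply: DeriveDef; first exact: derivableV.
by rewrite deriveV// derive_val -[_ *: _]/(_ * _) mulr1 exprVn.
Qed.

(** K has characteristic zero, so it is infinite: multiplied by the product of
  the X - a for a in s, the polynomial has all natural numbers as roots. *)
Lemma poly_eq0_off_seq (K : numFieldType) (p : {poly K}) (s : seq K) :
  (forall z, z \notin s -> p.[z] = 0) -> p = 0.
Proof.
move=> ps; apply/eqP/negPn/negP => p0.
pose q := p * \prod_(a <- s) ('X - a%:P).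
have q0 : q != 0.
  by rewrite mulf_neq0// monic_neq0// monic_prod_XsubC.
have qr z : root q z.
  rewrite rootM; case: (boolP (z \in s)) => zs.
    by rewrite root_prod_XsubC zs orbT.
  by rewrite rootE ps// eqxx.
have := @max_poly_roots _ q [seq k%:R | k <- iota 0 (size q)] q0.
rewrite size_map size_iota ltnn => H; suff : false by []; apply: H.
  by apply/allP => z _; exact: qr.
by rewrite map_inj_uniq ?iota_uniq// => i j /eqP; rewrite eqr_nat => /eqP.
Qed.

(** The three quadratics form, up to scalars, a Lagrange basis at the nodes
  0, al, be, so it suffices to evaluate at these nodes. *)
Lemma lagrange_eq0 (K : numFieldType) (al be t0 t1 t2 : K) :
  al != 0 -> be != 0 -> al != be ->
  (forall z, z != 0 -> z != al -> z != be ->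
    t0 * (z - al) * (z - be) + t1 * z * (z - be) + t2 * z * (z - al) = 0) ->
  [/\ t0 = 0, t1 = 0 & t2 = 0].
Proof.
move=> al0 be0 albe tz.
pose P : {poly K} := t0 *: (('X - al%:P) * ('X - be%:P)) + t1 *: ('X * ('X - be%:P))
  + t2 *: ('X * ('X - al%:P)).
have PE z : P.[z] = t0 * (z - al) * (z - be) + t1 * z * (z - be) + t2 * z * (z - al).
  by rewrite /P !hornerE/= ?mulrA.
have P0 : P = 0.
  apply: (@poly_eq0_off_seq _ _ [:: 0; al; be]) => z; rewrite !inE !negb_or.
  by case/and3P => z0 za zb; rewrite PE tz.
have E z : t0 * (z - al) * (z - be) + t1 * z * (z - be) + t2 * z * (z - al) = 0.
  by rewrite -PE P0 horner0.
have := E 0; have := E al; have := E be.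
rewrite !(subrr, mulr0, mul0r, add0r, addr0, sub0r) => hb ha h0.
split; apply/eqP; [move/eqP: h0|move/eqP: ha|move/eqP: hb];
  by rewrite !mulf_eq0 ?oppr_eq0 ?subr_eq0 ?(negPf al0) ?(negPf be0)
             ?(negPf albe) ?(eq_sym be al) ?(negPf albe) ?orbF.
Qed.

(** After multiplication by (z - al) (z - be) the expression becomes a polynomial
  identity: m and n are read off at al and be, and an affine function that
  vanishes off three points remains. *)
Lemma heun_potential_eq0 (K : numFieldType) (al be e f m n : K) :
  al != 0 -> be != 0 -> al != be ->
  (forall z, z != 0 -> z != al -> z != be ->
    e * z + f + z * (al - be) * (m / (z - al) - n / (z - be)) = 0) ->
  [/\ m = 0, n = 0, e = 0 & f = 0].
Proof.
move=> al0 be0 albe ez.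
pose P : {poly K} := (e *: 'X + f%:P) * (('X - al%:P) * ('X - be%:P)) +
  (al - be) *: 'X * (m *: ('X - be%:P) - n *: ('X - al%:P)).
have PE z : P.[z] = (e * z + f) * ((z - al) * (z - be)) +
    (al - be) * z * (m * (z - be) - n * (z - al)).
  by rewrite /P !hornerE/= ?mulrA.
have P0 : P = 0.
  apply: (@poly_eq0_off_seq _ _ [:: 0; al; be]) => z; rewrite !inE !negb_or.
  case/and3P => z0 za zb; rewrite PE.
  rewrite -[RHS](mul0r ((z - al) * (z - be))) -(ez z z0 za zb).
  by field; rewrite !subr_eq0 za zb.
have E z : (e * z + f) * ((z - al) * (z - be)) +
    (al - be) * z * (m * (z - be) - n * (z - al)) = 0.
  by rewrite -PE P0 horner0.
have m0 : m = 0.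
  apply/eqP; have /eqP := E al.
  have -> : (e * al + f) * ((al - al) * (al - be)) +
    (al - be) * al * (m * (al - be) - n * (al - al)) =
    al * (al - be) * (m * (al - be)) by ring.
  by rewrite !mulf_eq0 !subr_eq0 (negPf al0) (negPf albe) !orbF.
have n0 : n = 0.
  apply/eqP; have /eqP := E be.
  have -> : (e * be + f) * ((be - al) * (be - be)) +
    (al - be) * be * (m * (be - be) - n * (be - al)) =
    be * (al - be) * (n * (al - be)) by ring.
  by rewrite !mulf_eq0 !subr_eq0 (negPf be0) (negPf albe) !orbF.
have Q0 : e *: 'X + f%:P = 0 :> {poly K}.
  apply: (@poly_eq0_off_seq _ _ [:: 0; al; be]) => z; rewrite !inE !negb_or.
  case/and3P => z0 za zb; rewrite -[RHS](ez z z0 za zb) m0 n0 !mul0r subr0 mulr0 addr0.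
  by rewrite !hornerE.
have := congr1 (horner^~ 0) Q0; have := congr1 (horner^~ 1) Q0.
rewrite !hornerE => ef f0; move: ef; rewrite f0 addr0 => e0.
by split.
Qed.

(** * Elimination of the first component *)

(** The algebra of the elimination at one point z: y1, y2 are the values of the
  two components, A, B the nonzero singularities, a11, a21, a22 the entries of
  the system matrix (the fourth one is - a21), and e1, e2 the first two
  derivatives of the second component. *)
Lemma elimination_identity (K : fieldType)
    (z A B b c nu nu' phi psi p q s u d y1 y2 : K) :
  z != 0 -> z - A != 0 -> z - B != 0 ->
  let a11 := nu * z^-1 + phi * (z - A)^-1 + (psi - nu - c) * (z - B)^-1 in
  let a21 := b * (z - B)^-1 - b * (z - A)^-1 in
  let a22 := (phi - nu' - c) * (z - A)^-1 + psi * (z - B)^-1 in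
  let e1 := a21 * y1 + a22 * y2 in
  let e2 := (b * (z - A)^-1 ^+ 2 - b * (z - B)^-1 ^+ 2) * y1
    + a21 * (a11 * y1 - a21 * y2)
    - ((phi - nu' - c) * (z - A)^-1 ^+ 2 + psi * (z - B)^-1 ^+ 2) * y2
    + a22 * e1 in
  z * (z - A) * (z - B) * e2
    + (p * (z - A) * (z - B) + q * z * (z - B) + s * z * (z - A)) * e1
    + (u * z + d) * y2
  = ((p - - nu) * (z - A) * (z - B) + (q - (nu' + c + 1 - 2 * phi)) * z * (z - B)
      + (s - (nu + c + 1 - 2 * psi)) * z * (z - A)) * e1
    + ((u - (nu' + c - phi - psi) * (c + 1 - phi - psi)) * z
       + (d - nu * ((c + nu' - phi) * B - psi * A))
       + z * (A - B) * ((phi * (nu' + c - phi) - b ^+ 2) / (z - A)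
           - (psi * (nu + c - psi) - b ^+ 2) / (z - B))) * y2.
Proof. by move=> z0 zA zB /=; field; rewrite z0 zA zB. Qed.

Section System.
Variables (R : realType) (alpha b c : R) (nu phi psi : R[i]).
Hypotheses (alpha_gt0 : 0 < alpha) (alpha_neq1 : alpha != 1) (b_neq0 : b != 0).

Local Notation al := (alpha%:C : R[i]).
Local Notation be := (alpha%:C^-1 : R[i]).

Let al0 : al != 0. Proof. by rewrite (fmorph_eq0 (real_complex R)) gt_eqF. Qed.
Let be0 : be != 0. Proof. by rewrite invr_eq0. Qed.
Let albe : al != be.
Proof.
apply: contra alpha_neq1 => /eqP ab; have : alpha%:C ^+ 2 = 1 :> R[i].
  by rewrite expr2 {2}ab mulfV.
rewrite -rmorphXn -[1](rmorph1 (real_complex R)) => /complexI.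
by move/eqP; rewrite sqrf_eq1 => /orP[//|/eqP aN]; move: alpha_gt0; rewrite aN ltr0N1.
Qed.
Let bC0 : b%:C != 0 :> R[i]. Proof. by rewrite (fmorph_eq0 (real_complex R)). Qed.

Definition coef21 (z : R[i]) : R[i] := b%:C * (z - be)^-1 - b%:C * (z - al)^-1.
Definition coef22 (z : R[i]) : R[i] :=
  (phi - nu^* - c%:C) * (z - al)^-1 + psi * (z - be)^-1.

Lemma system_mx_row0 (z : R[i]) (Y : 'cV[R[i]]_2) :
  (system_mx alpha b c nu phi psi z *m Y) 0 0 =
  (nu * z^-1 + phi * (z - al)^-1 + (psi - nu - c%:C) * (z - be)^-1) * Y 0 0
  - coef21 z * Y 1 0.
Proof.
rewrite !mxE !big_ord_recl big_ord0 /= !mxE /= /coef21.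
by rewrite (_ : lift ord0 ord0 = 1 :> 'I_2) //=; [ring | apply/val_inj].
Qed.

Lemma system_mx_row1 (z : R[i]) (Y : 'cV[R[i]]_2) :
  (system_mx alpha b c nu phi psi z *m Y) 1 0 = coef21 z * Y 0 0 + coef22 z * Y 1 0.
Proof.
rewrite !mxE !big_ord_recl big_ord0 /= !mxE /= /coef21 /coef22.
by rewrite (_ : lift ord0 ord0 = 1 :> 'I_2) //=; [ring | apply/val_inj].
Qed.

Definition poles (j : 'I_3) : R[i] := [:: 0; al; be]`_j.
Definition residues (j : 'I_3) : 'M[R[i]]_2 :=
  [:: mx22 nu 0 0 0;
      mx22 phi b%:C (- b%:C) (phi - nu^* - c%:C);
      mx22 (psi - nu - c%:C) (- b%:C) b%:C psi]`_j.

Lemma system_mx_fuchsian z :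
  system_mx alpha b c nu phi psi z = \sum_j (z - poles j)^-1 *: residues j.
Proof.
by rewrite !big_ord_recl big_ord0 /poles /residues /= subr0 addr0 addrA.
Qed.

Lemma system_local_solution (z0 : R[i]) (y0 : 'cV[R[i]]_2) :
  z0 != 0 -> z0 != al -> z0 != be ->
  exists (U : set R[i]) (Y : R[i] -> 'cV[R[i]]_2),
    [/\ open U, U z0, Y z0 = y0,
      forall z, U z -> [/\ z != 0, z != al & z != be] &
      system_solution alpha b c nu phi psi U Y].
Proof.
move=> z00 z0a z0b.
have zp j : z0 != poles j by case: j => -[|[|[|//]]] /= ?.
have [r [Y [r0 Y0 YU]]] := fuchsian_local_solution residues y0 zp.
exists (ball z0 r), Y.
have ballE z : ball z0 r z -> `|z - z0| < r by rewrite -ball_normE /= distrC.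
split=> [| |//|z /ballE /YU [zj _]|z /ballE /YU [_]].
- exact: ball_open.
- exact: ballxx.
- split; first exact: (zj (@Ordinal 3 0 isT)).
    exact: (zj (@Ordinal 3 1 isT)).
  exact: (zj (@Ordinal 3 2 isT)).
- by rewrite system_mx_fuchsian.
Qed.

Let is_derive_coef (x y z : R[i]) : z != al -> z != be ->
  is_derive z 1 (fun w : R[i] => x * (w - al)^-1 + y * (w - be)^-1)
    (- (x * (z - al)^-1 ^+ 2 + y * (z - be)^-1 ^+ 2)).
Proof.
move=> /is_derive_invB da /is_derive_invB db.
have H := is_deriveD (is_deriveZ x da) (is_deriveZ y db).
by apply: is_derive_eq H _; rewrite /GRing.scale/=; ring.
Qed.

Section Solution.
Variables (U : set R[i]) (Y : R[i] -> 'cV[R[i]]_2).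
Hypotheses (Uopen : open U)
  (Unonsingular : forall z, U z -> [/\ z != 0, z != al & z != be])
  (Ysol : system_solution alpha b c nu phi psi U Y).
Variables (z : R[i]) (Uz : U z).

Local Notation E := (fun w => Y w 1 0).

Lemma second_component_derive w : U w ->
  is_derive w 1 E (coef21 w * Y w 0 0 + coef22 w * Y w 1 0).
Proof.
by move=> /Ysol /is_derive_mxP /(_ 1 0); rewrite system_mx_row1.
Qed.

Lemma second_component_derive1 w : U w ->
  derive1 E w = coef21 w * Y w 0 0 + coef22 w * Y w 1 0.
Proof.
move=> Uw; rewrite derive1E.
exact: (@derive_val _ _ _ _ _ _ _ (second_component_derive Uw)).
Qed.

(** Differentiates the second row of the system, using the first row for the
  derivative of Y_1. *)
Lemma second_component_derive2 :
  is_derive z 1 (derive1 E)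
    ((b%:C * (z - al)^-1 ^+ 2 - b%:C * (z - be)^-1 ^+ 2) * Y z 0 0
     + coef21 z *
         ((nu * z^-1 + phi * (z - al)^-1 + (psi - nu - c%:C) * (z - be)^-1) * Y z 0 0
         - coef21 z * Y z 1 0)
     - ((phi - nu^* - c%:C) * (z - al)^-1 ^+ 2 + psi * (z - be)^-1 ^+ 2) * Y z 1 0
     + coef22 z * (coef21 z * Y z 0 0 + coef22 z * Y z 1 0)).
Proof.
have [z0 za zb] := Unonsingular Uz.
pose G w : R[i] := coef21 w * Y w 0 0 + coef22 w * Y w 1 0.
have near_eq : \forall w \near z,
    G w = derive1 E w.
  move: (open_nbhs_nbhs (conj Uopen Uz)); apply: filterS => w Uw.
  by rewrite second_component_derive1.
apply: (@near_eq_is_derive _ _ _ G (derive1 E) z 1 _ near_eq).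
have d21 : is_derive z 1 coef21
    (- (- b%:C * (z - al)^-1 ^+ 2 + b%:C * (z - be)^-1 ^+ 2)).
  have -> : coef21 = (fun w => (- b%:C) * (w - al)^-1 + b%:C * (w - be)^-1).
    by apply/funext => w; rewrite /coef21; ring.
  exact: is_derive_coef.
have d22 := is_derive_coef (phi - nu^* - c%:C) psi za zb.
have dY1 : is_derive z 1 (fun w => Y w 0 0)
  ((nu * z^-1 + phi * (z - al)^-1 + (psi - nu - c%:C) * (z - be)^-1) * Y z 0 0
    - coef21 z * Y z 1 0).
  by have := Ysol Uz; move=> /is_derive_mxP /(_ 0 0); rewrite system_mx_row0.
have dY2 := second_component_derive Uz.
apply: is_derive_eq (is_deriveD (is_deriveM d21 dY1) (is_deriveM d22 dY2)) _.
by rewrite -/(coef22 z) /GRing.scale/=; ring.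
Qed.

(** For every Heun equation with the singularities of the system, the failure of
  Y_2 to satisfy it, expressed through its difference from H0. For H0 itself only
  the double-pole terms remain. *)
Lemma second_component_heun_residual (p q s u d : R[i]) :
  let H0 := corresponding_heun alpha c nu phi psi in
  z * (z - al) * (z - be) * derive1 (derive1 E) z
    + (p * (z - al) * (z - be) + q * z * (z - be) + s * z * (z - al)) * derive1 E z
    + (u * z + d) * E z
  = ((p - heun_p H0) * (z - al) * (z - be) + (q - heun_q H0) * z * (z - be)
      + (s - heun_s H0) * z * (z - al)) * derive1 E z
    + ((u - heun_u H0) * z + (d - heun_d H0)
       + z * (al - be) * ((phi * (nu^* + c%:C - phi) - b%:C ^+ 2) / (z - al)
           - (psi * (nu + c%:C - psi) - b%:C ^+ 2) / (z - be))) * E z.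
Proof.
have [z0 za zb] := Unonsingular Uz; rewrite -subr_eq0 in za; rewrite -subr_eq0 in zb.
rewrite [derive1 (derive1 _) z]derive1E.
rewrite (@derive_val _ _ _ _ _ _ _ second_component_derive2).
rewrite (second_component_derive1 Uz) /= /coef21 /coef22.
exact: elimination_identity.
Qed.

End Solution.
Let coef21_neq0 z : coef21 z != 0.
Proof.
rewrite /coef21 -mulrBr mulf_neq0// subr_eq0 (inj_eq invr_inj).
by rewrite (inj_eq (addrI z)) eqr_opp eq_sym.
Qed.

(** The operator of H applied to E = Y_2 equals T E' + S E, so H is satisfied as
  soon as T = S = 0; since (E, E') takes arbitrary values at each nonsingular
  point, this is also necessary. *)
Lemma reduces_to_heunP (H : heun_equation R) :
  heun_alpha H = al -> heun_beta H = be ->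
  reduces_to_heun alpha b c nu phi psi H <->
  [/\ b%:C ^+ 2 = phi * (nu^* + c%:C - phi), b%:C ^+ 2 = psi * (nu + c%:C - psi) &
      H = corresponding_heun alpha c nu phi psi].
Proof.
case: H => A B p q s u d /= -> ->{A B}.
set H0 := corresponding_heun _ _ _ _ _.
split=> [red|[mE nE [-> -> -> -> ->]] U Y Uo Uns Ysol z Uz]; last first.
  split; first exact: (@ex_derive _ _ _ _ _ _ _ (second_component_derive Ysol Uz)).
    exact: (@ex_derive _ _ _ _ _ _ _ (second_component_derive2 Uo Uns Ysol Uz)).
  rewrite (second_component_heun_residual Uo Uns Ysol Uz) -mE -nE /=.
  by rewrite !subrr !mul0r subrr mulr0 !(addr0, mul0r).
pose T z := (p - heun_p H0) * (z - al) * (z - be) + (q - heun_q H0) * z * (z - be)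
      + (s - heun_s H0) * z * (z - al).
pose m := phi * (nu^* + c%:C - phi) - b%:C ^+ 2.
pose n := psi * (nu + c%:C - psi) - b%:C ^+ 2.
pose S z := (u - heun_u H0) * z + (d - heun_d H0)
   + z * (al - be) * (m / (z - al) - n / (z - be)).
have TS y1 y2 z : z != 0 -> z != al -> z != be ->
    T z * (coef21 z * y1 + coef22 z * y2) + S z * y2 = 0.
  move=> z0 za zb.
  (* y1, y2 are arbitrary initial values of the two components at z. *)
  have [U [Y [Uo Uz Yz Uns Ysol]]] :=
    system_local_solution (\col_i (if i == 0 then y1 else y2)) z0 za zb.
  have [_ _] := red U Y Uo Uns Ysol z Uz.
  rewrite (second_component_heun_residual Uo Uns Ysol Uz).
  by rewrite (second_component_derive1 Ysol Uz) Yz !mxE.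
have T0 z : z != 0 -> z != al -> z != be -> T z = 0.
  move=> z0 za zb; have := TS 1 0 z z0 za zb.
  rewrite !mulr0 mulr1 !addr0 => /eqP.
  by rewrite mulf_eq0 (negPf (coef21_neq0 z)) orbF => /eqP.
have S0 z : z != 0 -> z != al -> z != be -> S z = 0.
  by move=> z0 za zb; have := TS 0 1 z z0 za zb; rewrite T0// mul0r add0r mulr1.
have [p0 q0 s0] := lagrange_eq0 al0 be0 albe T0.
have [m0 n0 u0 d0] := heun_potential_eq0 al0 be0 albe S0.
split; [exact/esym/subr0_eq|exact/esym/subr0_eq|].
rewrite -[H0]/(Heun al be (heun_p H0) (heun_q H0) (heun_s H0) (heun_u H0) (heun_d H0)).
by rewrite (subr0_eq p0) (subr0_eq q0) (subr0_eq s0) (subr0_eq u0) (subr0_eq d0).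
Qed.

End System.

(** * The reduction theorem *)

Lemma quadratic_root_pair (C : idomainType) (t w x : C) :
  forall y, y * (t - y) = w -> x * (t - x) = w <-> (x = y \/ x = t - y).
Proof.
move=> y yw; split=> [xw|[->|->]] //; last by rewrite -yw; ring.
have /eqP : (x - y) * (x - (t - y)) = 0.
  by rewrite -(subrr w) -{1}yw -xw; ring.
by rewrite mulf_eq0 !subr_eq0 => /orP[/eqP|/eqP]; [left|right].
Qed.

Theorem theorem17 (R : realType) :
  (forall (alpha b c : R) (nu phi psi : R[i]),
     0 < alpha -> 0 <= b -> alpha != 1 -> b != 0 ->
     let cond_ii :=
       [/\ b%:C ^+ 2 = phi * (nu^* + c%:C - phi),
           phi * (nu^* + c%:C - phi) = psi * (nu + c%:C - psi),
           0 <= psi * (nu + c%:C - psi) &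
           psi = phi^* \/ psi = nu + c%:C - phi^*] in
     let H0 := corresponding_heun alpha c nu phi psi in
     (* 1 *)
     (equivalent_to_heun alpha b c nu phi psi <-> cond_ii) /\
     (* 2 *)
     (cond_ii ->
       [/\ (forall H : heun_equation R,
              heun_alpha H = alpha%:C -> heun_beta H = alpha%:C^-1 ->
              (reduces_to_heun alpha b c nu phi psi H <-> H = H0)),
           (psi = phi^* -> heun_s H0 = (heun_q H0)^*) &
           (psi = nu + c%:C - phi^* -> heun_s H0 = 2 - (heun_q H0)^*)]))
  /\
  (* the family of these Heun equations and its parameters *)
  (forall H : heun_equation R,
     (exists (alpha b c : R) (nu phi psi : R[i]),
        [/\ 0 < alpha, 0 <= b, alpha != 1 & b != 0] /\
        [/\ heun_alpha H = alpha%:C, heun_beta H = alpha%:C^-1 &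
            reduces_to_heun alpha b c nu phi psi H])
     <->
     (exists (nu : R[i]) (alpha c : R) (phi psi : R[i]),
        [/\ 0 < alpha, alpha != 1,
            0 < phi * (nu^* + c%:C - phi) &
            psi = phi^* \/ psi = nu + c%:C - phi^*] /\
        H = corresponding_heun alpha c nu phi psi))
  /\
  (* the constraint on phi leaves one real parameter t, up to a double choice;
     together with Re nu, Im nu, alpha and c this makes five *)
  (forall (nu : R[i]) (c t : R), 0 < t ->
     exists phi0 : R[i], forall phi : R[i],
       phi * (nu^* + c%:C - phi) = t%:C <->
       (phi = phi0 \/ phi = nu^* + c%:C - phi0)).
Proof.
have conj_real (x : R) : (x%:C : R[i])^* = x%:C by exact: conjc_real.
have b2_gt0 (b : R) : b != 0 -> 0 < (b%:C : R[i]) ^+ 2.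
  by move=> b0; rewrite -rmorphXn ltcR exprn_even_gt0.
(* The right-hand quadratic is the conjugate of the one for phi, so phi^* is one
   of its roots and nu + c - phi^* the other. *)
have psiP (b c : R) (nu phi psi : R[i]) :
    b%:C ^+ 2 = phi * (nu^* + c%:C - phi) ->
    b%:C ^+ 2 = psi * (nu + c%:C - psi) <-> (psi = phi^* \/ psi = nu + c%:C - phi^*).
  move=> bphi; have conj_phi : phi^* * (nu + c%:C - phi^*) = b%:C ^+ 2.
    have := congr1 (@Num.conj _) bphi.
    by rewrite rmorphXn [LHS]/= conj_real
               rmorphM rmorphB rmorphD /= conjCK conj_real => <-.
  have [h1 h2] := quadratic_root_pair psi conj_phi.
  by split=> [/esym/h1|/h2/esym].
have main (alpha b c : R) (nu phi psi : R[i]) (H : heun_equation R) :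
    0 < alpha -> alpha != 1 -> b != 0 ->
    heun_alpha H = alpha%:C -> heun_beta H = alpha%:C^-1 ->
    reduces_to_heun alpha b c nu phi psi H <->
    [/\ b%:C ^+ 2 = phi * (nu^* + c%:C - phi),
        (psi = phi^* \/ psi = nu + c%:C - phi^*) &
        H = corresponding_heun alpha c nu phi psi].
  move=> a0 a1 b0 Ha Hb; split=> [/(reduces_to_heunP c nu phi psi a0 a1 b0 Ha Hb)|].
    by move=> [bphi bpsi HE]; split=> //; exact: (psiP _ _ _ _ _ bphi).1 bpsi.
  move=> [bphi psiE HE]; apply/(reduces_to_heunP c nu phi psi a0 a1 b0 Ha Hb).
  by split=> //; exact: (psiP _ _ _ _ _ bphi).2 psiE.
split; last split.
- move=> alpha b c nu phi psi a0 b_ge0 a1 b0 cond_ii H0.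
  split; first split.
  + move=> [H [Ha Hb /(main _ _ _ _ _ _ _ a0 a1 b0 Ha Hb) [bphi psiE _]]].
    have bpsi := (psiP _ _ _ _ _ bphi).2 psiE.
    by split=> //; rewrite -bpsi // ltW// b2_gt0.
  + move=> [bphi phipsi _ psiE]; exists H0; split=> //.
    exact/(main _ _ _ _ _ _ H0 a0 a1 b0).
  + move=> [bphi phipsi _ psiE]; split=> [H Ha Hb| |].
    * split=> [/(main _ _ _ _ _ _ _ a0 a1 b0 Ha Hb) [] //|HE].
      exact/(main _ _ _ _ _ _ _ a0 a1 b0 Ha Hb).
    * by move=> psi_eq; rewrite /H0 /= psi_eq
        !(rmorphB, rmorphD, rmorphM, rmorph1, rmorph_nat) /= conjCK conj_real.
    * move=> psi_eq; rewrite /H0 /= psi_eq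
        !(rmorphB, rmorphD, rmorphM, rmorph1, rmorph_nat) /= conjCK conj_real.
      by ring.
- move=> H; split.
    move=> [alpha [b [c [nu [phi [psi [[a0 b_ge0 a1 b0] [Ha Hb]]]]]]]].
    move=> /(main _ _ _ _ _ _ _ a0 a1 b0 Ha Hb) [bphi psiE HE].
    exists nu, alpha, c, phi, psi; split=> //; split=> //.
    by rewrite -bphi b2_gt0.
  move=> [nu [alpha [c [phi [psi [[a0 a1 t0 psiE] HE]]]]]].
  set t := phi * _ in t0.
  have tE : t = (complex.Re t)%:C by rewrite RRe_real// gtr0_real.
  have Ret0 : 0 < complex.Re t by rewrite -ltcR -tE.
  exists alpha, (Num.sqrt (complex.Re t)), c, nu, phi, psi.
  have b0 : Num.sqrt (complex.Re t) != 0 by rewrite gt_eqF ?sqrtr_gt0.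
  split; first by split=> //; exact: sqrtr_ge0.
  split; [by rewrite HE|by rewrite HE|].
  apply/main => //; [by rewrite HE|by rewrite HE|split=> //].
  by rewrite -rmorphXn /= sqr_sqrtr ?ltW// -tE.
- move=> nu c t _; pose w := nu^* + c%:C.
  exists ((w + sqrtC (w ^+ 2 - 4 * t%:C)) / 2) => phi.
  apply: quadratic_root_pair; rewrite -/w.
  set r := sqrtC _; have rr : r ^+ 2 = w ^+ 2 - 4 * t%:C by exact: sqrtCK.
  have -> : (w + r) / 2 * (w - (w + r) / 2) = (w ^+ 2 - r ^+ 2) / 4 by field.
  by rewrite rr; field.
Qed.
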